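(* Let $S$ be a semigroup and let $\mathcal{F}=\langle F_i\rangle_{i\in I}$ be a net in $\mathcal{P}_f(S)$. Suppose that at least one of the following two conditions holds: (1) there is some $b\in\mathbb{N}$ such that $S$ is $b$-weakly right cancellative; (2) there is some $b\in\mathbb{N}$ such that $S$ is $b$-weakly left cancellative, and $\mathcal{F}$ satisfies condition $( * )$. Then a subset $A\subseteq S$ is a $D$-set with respect to $\mathcal{F}$ if and only if there exist a dynamical system $(X,\langle T_s\rangle_{s\in S})$ and points $x,y\in X$ such that for every neighborhood $U$ of $y$, $d_{\mathcal{F}}^*(\{s\in S: T_s(x)\in U\text{ and }T_s(y)\in U\})>0$, and for some neighborhood $U_y$ of $y$, $A=\{s\in S: T_s(x)\in U_y\}$.
   Context: Semigroups are nonempty and discrete; $\mathbb{N}=\{1,2,\dots\}$; $\mathcal{P}_f(X)$ is the set of finite nonempty subsets of $X$. $\beta S$ is the space of ultrafilters on $S$ (Stone–Čech compactification), with basic open sets $\overline{A}=\{p\in\beta S: A\in p\}$ for $A\subseteq S$, and semigroup operation $pq=\{A\subseteq S:\{s\in S: s^{-1}A\in q\}\in p\}$, where $s^{-1}A=\{t\in S: st\in A\}$. For a net $\mathcal{F}=\langle F_i\rangle_{i\in I}$ in $\mathcal{P}_f(S)$ ($I$ a directed set) and $A\subseteq S$, the upper Banach density of $A$ with respect to $\mathcal{F}$ is $$d_{\mathcal{F}}^*(A)=\sup\{\alpha: (\forall i_0\in I)(\exists i\geq i_0)(\exists s\in S\cup\{1\})(|A\cap(F_i\cdot s)|\geq\alpha|F_i|)\},$$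 where $F_i\cdot 1$ means $F_i$ ($S$ is not assumed to have an identity). Put $D_{\mathcal{F}}^*=\{p\in\beta S:(\forall A\in p)(d_{\mathcal{F}}^*(A)>0)\}$. A subset $A\subseteq S$ is a $D$-set with respect to $\mathcal{F}$ if $A\in p$ for some idempotent $p$ ($pp=p$) of $\beta S$ with $p\in D_{\mathcal{F}}^*$. $S$ is $b$-weakly left cancellative (respectively $b$-weakly right cancellative) if for all $t,u\in S$, $|\{s\in S: ts=u\}|\leq b$ (respectively $|\{s\in S: st=u\}|\leq b$). Condition $( * )$ for $\mathcal{F}$: $(\forall\epsilon>0)(\forall t\in S)(\exists c\in\mathbb{N})(\exists l\in I)(\forall i_0\geq l)(\exists i\geq i_0)(\exists s\in S\cup\{1\})\big(|(t\cdot F_{i_0})\setminus(F_i\cdot s)|<\epsilon\cdot|F_{i_0}|\text{ and }|F_i|\leq c\cdot|F_{i_0}|\big)$. A dynamical system is a pair $(X,\langle T_s\rangle_{s\in S})$ where $X$ is a compact Hausdorff space, $S$ is a semigroup, each $T_s:X\to X$ is continuous, and $T_{st}=T_s\circ T_t$ for all $s,t\in S$. *)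

(* Defs.v *)
From HB Require Import structures.
From mathcomp Require Import all_boot all_order all_algebra finmap.
From mathcomp Require Import boolp classical_sets functions cardinality filter.
From mathcomp Require Import reals topology.

Set Implicit Arguments.
Unset Strict Implicit.
Unset Printing Implicit Defensive.

Import Order.TTheory GRing.Theory Num.Theory.

Local Open Scope classical_set_scope.
Local Open Scope ring_scope.

Definition directed (I : Type) (le : I -> I -> Prop) : Prop :=
  [/\ inhabited I,
      forall i, le i i,
      forall i j k, le i j -> le j k -> le i k &
      forall i j, exists k, le i k /\ le j k].

Section Semigroup.
Variable S : semigroupType.
Implicit Types (A : set S) (p q : set_system S) (E : {fset S}) (s t u : S).

Definition left_quotient s A : set S := [set t | A (s * t)%g].

Definition betaS : set (set_system S) := [set p | UltraFilter p].

Definition beta_mul p q : set_system S :=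
  [set A | p [set s | q (left_quotient s A)]].

Definition ltranslate t E : {fset S} := [fset (t * e)%g | e in E]%fset.

(* [option S] encodes S u {1}, with [None] the adjoined element 1; this
   element is distinct from an identity of S, should S have one, but both act
   on finite subsets of S in the same way. *)
Definition rtranslate E (s : option S) : {fset S} :=
  if s is Some s' then [fset (e * s')%g | e in E]%fset else E.

Definition weakly_left_cancellative (b : nat) : Prop :=
  forall t u, ([set s | (t * s)%g = u] #<= `I_b)%card.

Definition weakly_right_cancellative (b : nat) : Prop :=
  forall t u, ([set s | (s * t)%g = u] #<= `I_b)%card.

Section Density.
Variables (R : realType) (I : Type) (le : I -> I -> Prop) (F : I -> {fset S}).

(* For [le] directed and all [F i] nonempty this set of reals contains 0 and
   is bounded above by 1, so that [sup] is a genuine least upper bound. *)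
Definition upper_banach_density A : R :=
  sup [set alpha : R |
    forall i0, exists2 i, le i0 i &
    exists s : option S,
      alpha * #|` F i|%:R <=
        #|` [fset a in rtranslate (F i) s | a \in A]%fset|%:R].

Definition Dstar : set (set_system S) :=
  [set p | betaS p /\ forall A, p A -> 0 < upper_banach_density A].

Definition D_set A : Prop :=
  exists p, [/\ betaS p, beta_mul p p = p, Dstar p & p A].

Definition condition_star : Prop :=
  forall (eps : R) t, 0 < eps ->
  exists2 c : nat, (0 < c)%N &
  exists l : I, forall i0, le l i0 ->
  exists2 i, le i0 i &
  exists s : option S,
    #|` (ltranslate t (F i0) `\` rtranslate (F i) s)%fset|%:R
      < eps * #|` F i0|%:R
    /\ (#|` F i| <= c * #|` F i0|)%N.

End Density.

Definition dynamical_system (X : topologicalType) (T : S -> X -> X) : Prop :=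
  [/\ compact [set: X], hausdorff_space X,
      forall s, continuous (T s) &
      forall s t, T (s * t)%g = T s \o T t].

End Semigroup.

Arguments weakly_left_cancellative : clear implicits.
Arguments weakly_right_cancellative : clear implicits.
Arguments upper_banach_density {S} R {I} le F A.
Arguments Dstar {S} R {I} le F.
Arguments D_set {S} R {I} le F A.
Arguments condition_star {S} R {I} le F.

(* Main.v *)
(* Given an idempotent [p] in D* with [A] in [p], let [S] act by right
   translation on {0,1}^(S u {1}), let [x] be the indicator function of [A] and
   [y] the limit of [T_s x] along [p]; since [pp = p], [T_s y] tends to [y]
   along [p] as well.

   Conversely, the sets of density zero form an ideal, so the ultrafilters in D*
   along which both [T_s x] and [T_s y] tend to [y] form a nonempty closed set.
   It is a subsemigroup because D* is closed under products: D* is a right ideal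
   under (1), and a left ideal under (2).  An idempotent in it, which exists by
   Ellis' theorem, witnesses that [{s | T_s x \in U_y}] is a D-set. *)
Require Import Defs.
From mathcomp Require Import all_boot all_order all_algebra finmap.
From mathcomp Require Import boolp classical_sets functions cardinality filter.
From mathcomp Require Import reals topology.

Set Implicit Arguments.
Unset Strict Implicit.
Unset Printing Implicit Defensive.

Import Order.TTheory GRing.Theory Num.Theory.

Local Open Scope classical_set_scope.
Local Open Scope ring_scope.

(** * Ultrafilters and the filters below them *)

Section Ultrafilters.
Variable T : Type.
Implicit Types (A B : set T) (p G : set_system T).

Lemma ultra_setC p A : UltraFilter p -> p (~` A) <-> ~ p A.
Proof.
move=> pU; split=> [pAC pA|npA].
  by apply: (@filter_not_empty _ p); rewrite -(setICr A); exact: filterI.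
by case: (in_ultra_setVsetC A pU).
Qed.

Lemma prime_ultra p :
  ProperFilter p -> (forall A, p A \/ p (~` A)) -> UltraFilter p.
Proof.
move=> pF pP; split=> // G GF pG; rewrite eqEsubset; split=> // A GA.
case: (pP A) => // /pG GAC; exfalso.
by apply: (@filter_not_empty _ G); rewrite -(setICr A); exact: filterI.
Qed.

(** If [A] is not in [G], the sets [B] with [A] u [B] in [G] form a proper filter that extends [G]
    and contains the complement of [A]; an ultrafilter above it avoids [A]. *)
Lemma filter_ultraP G A : Filter G ->
  (forall p, UltraFilter p -> G `<=` p -> p A) -> G A.
Proof.
move=> GF pA; apply: contrapT => nGA.
pose H := [set B | G (A `|` B)].
have HF : ProperFilter H.
  split; first by rewrite /H /= setU0.
  split=> [|B C HB HC|B C BC HB]; rewrite /H /=.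
  - by rewrite setUT; exact: filterT.
  - by rewrite setUIr; exact: filterI.
  - by apply: (@filterS _ G _ _ _ _ HB) => x [Ax|/BC Cx]; [left|right].
have [p [pU Hp]] := ultraFilterLemma HF.
have pAC : p (~` A) by apply: Hp; rewrite /H /= setUCr; exact: filterT.
move/(ultra_setC _ pU): pAC; apply; apply: pA => // B GB.
by apply: Hp; apply: filterS GB => x Bx; right.
Qed.

End Ultrafilters.

(** * The semigroup of ultrafilters and its idempotents *)

Section BetaSemigroup.
Variable S : semigroupType.
Implicit Types (A B : set S) (p q r G : set_system S) (s t : S).

Lemma left_quotientM s t A :
  left_quotient t (left_quotient s A) = left_quotient (s * t)%g A.
Proof. by apply/funext => u; rewrite /left_quotient /= mulgA. Qed.

Lemma beta_mulA p q r :
  beta_mul p (beta_mul q r) = beta_mul (beta_mul p q) r.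
Proof.
apply/funext => A; rewrite /beta_mul /=; congr (p _); apply/funext => s /=.
by congr (q _); apply/funext => t /=; rewrite left_quotientM.
Qed.

Lemma beta_mul_proper p q :
  ProperFilter p -> ProperFilter q -> ProperFilter (beta_mul p q).
Proof.
move=> pF qF; apply: Build_ProperFilter_ex.
  move=> A /(@filter_ex _ p pF)[s /(@filter_ex _ q qF)[t At]].
  by exists (s * t)%g.
split=> [|A B pA pB|A B AB pA]; rewrite /beta_mul /=.
- by apply: filterE => s; exact: filterT.
- by apply: (@filterS2 _ p _ _ _ _ _ pA pB) => s; exact: filterI.
- by apply: (@filterS _ p _ _ _ _ pA) => s; apply: filterS => t; exact: AB.
Qed.

Lemma beta_mul_ultra p q :
  UltraFilter p -> UltraFilter q -> UltraFilter (beta_mul p q).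
Proof.
move=> pU qU; apply: prime_ultra; first exact: beta_mul_proper.
move=> A; have [pA|pAC] := in_ultra_setVsetC [set s | q (left_quotient s A)] pU.
  by left.
by right; apply: (@filterS _ p _ _ _ _ pAC) => s /(ultra_setC _ qU).
Qed.

(* The filter whose ultrafilters are the [q] above [G] with [q p = r]. *)
Definition right_division G p r : set_system S :=
  [set B | exists2 A, r A & G [set s | p (left_quotient s A) -> B s]].

(** This makes the equation [q p = r] solvable above [G]. If the empty set belonged to the filter,
    some [A] in [r] would have s^{-1}A outside [p] for [G]-most s, which puts the complement of [A]
    in [G p], hence in [r]. *)
Lemma right_division_proper G p r :
  ProperFilter G -> UltraFilter p -> UltraFilter r -> beta_mul G p `<=` r ->
  ProperFilter (right_division G p r).
Proof.
move=> GF pU rU Gpr; split.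
  move=> [A rA GA]; have : r (~` A).
    by apply: Gpr; apply: filterS GA => s /(ultra_setC _ pU).
  by move/(ultra_setC _ rU).
split=> [|B C [A rA GA] [A' rA' GA']|B C BC [A rA GA]].
- by exists setT; [exact: filterT|apply: filterE].
- exists (A `&` A'); first exact: filterI.
  apply: filterS2 GA GA' => s sB sC psAA'; split.
    by apply: sB; apply: filterS psAA' => t [].
  by apply: sC; apply: filterS psAA' => t [].
- by exists A => //; apply: filterS GA => s sB /sB /BC.
Qed.

Lemma right_divisionP G p q r :
  ProperFilter G -> UltraFilter p -> UltraFilter q -> UltraFilter r ->
  right_division G p r `<=` q <-> G `<=` q /\ beta_mul q p = r.
Proof.
move=> GF pU qU rU; split=> [Gq|[Gq <-] B [A qpA GA]].
  split=> [B GB|].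
    by apply: Gq; exists setT; [exact: filterT|apply: filterS GB => s Bs _].
  have qpU := beta_mul_ultra qU pU.
  apply: (@max_filter _ r rU _ (@ultra_proper _ _ qpU)) => A rA.
  by apply: Gq; exists A => //; apply: filterE => s psA.
by apply: (@filterS2 _ q _ _ _ _ _ qpA (Gq _ GA)) => s psA; apply.
Qed.

(** The ultrafilters above [G] form a nonempty closed set; the second clause makes it a
    subsemigroup. Larger filters give smaller subsemigroups. *)
Definition semigroup_filter G := ProperFilter G /\
  forall p q, UltraFilter p -> UltraFilter q -> G `<=` p -> G `<=` q ->
    G `<=` beta_mul p q.

Lemma maximal_semigroup_filter G0 : semigroup_filter G0 ->
  exists G, [/\ semigroup_filter G, G0 `<=` G &
    forall G', semigroup_filter G' -> G `<=` G' -> G' = G].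
Proof.
move=> G0S.
pose P G := G = set0 \/ (semigroup_filter G /\ G0 `<=` G).
have [C CP Ctot|G [GP Gmax]] := @Zorn_bigcup (set S) P.
  have [[X0 CX0 X0N]|CN] := pselect (exists2 X, C X & X <> set0); last first.
    left; rewrite -subset0 => A [X CX XA].
    by case: CN; exists X => // X0; rewrite X0 in XA.
  have good X A : C X -> X A -> semigroup_filter X /\ G0 `<=` X.
    by move=> CX XA; case: (CP X CX) => // XE; rewrite XE in XA.
  have [//|[[X0F _] G0X0]] := CP _ CX0.
  right; split; last by move=> A /G0X0 X0A; exists X0.
  split.
    split.
      by move=> [X CX XE]; have [[[]]] := good _ _ CX XE.
    split=> [|A B [X CX XA] [Y CY YB]|A B AB [X CX XA]].
    - by exists X0 => //; exact: filterT.
    - have [[XF _] _] := good _ _ CX XA; have [[YF _] _] := good _ _ CY YB.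
      case: (Ctot _ _ CX CY) => [XY|YX].
        by exists Y => //; apply: filterI => //; exact: XY.
      by exists X => //; apply: filterI => //; exact: YX.
    - have [[XF _] _] := good _ _ CX XA.
      by exists X => //; exact: filterS XA.
  move=> p q pU qU Cp Cq A [X CX XA].
  have [[_ XS] _] := good _ _ CX XA.
  by apply: XS XA => // B XB; [apply: Cp|apply: Cq]; exists X.
case: GP => [G0E|[GS G0G]].
  case: (Gmax G0); last by right; split.
  have [G0F _] := G0S; rewrite G0E; split=> // G00.
  by apply: (G00 setT); exact: filterT.
exists G; split=> // G' G'S GG'; apply: contrapT => G'N.
apply: (Gmax G'); last by right; split=> //; exact: subset_trans GG'.
by split=> // G'G; apply: G'N; rewrite eqEsubset.
Qed.

(* Ellis' theorem, with closed subsemigroups of [betaS S] given by filters: a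
   minimal closed subsemigroup [C] is a maximal semigroup filter [G], and the
   minimality of [C] is used against [C p] and [{q in C | q p = p}]. *)
Lemma idempotent_ultrafilter G0 : semigroup_filter G0 ->
  exists p, [/\ UltraFilter p, G0 `<=` p & beta_mul p p = p].
Proof.
move=> /maximal_semigroup_filter[G [[GF GS] G0G Gmax]].
have [p [pU Gp]] := ultraFilterLemma GF.
have GpF := beta_mul_proper GF (@ultra_proper _ _ pU).
(* The ultrafilters above the filter [G p] all lie in [C p], so this filter does represent [C p]. *)
have lift r : UltraFilter r -> beta_mul G p `<=` r ->
    exists q, [/\ UltraFilter q, G `<=` q & beta_mul q p = r].
  move=> rU Gpr.
  have [q [qU]] := ultraFilterLemma (right_division_proper GF pU rU Gpr).
  by move=> /(right_divisionP GF pU qU rU)[]; exists q.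
have GpE : beta_mul G p = G.
  apply: Gmax; last first.
    move=> A GA; apply: (@filter_ultraP _ G) => q qU Gq.
    exact: (GS q p).
  split=> // r1 r2 /lift r1E /lift r2E /r1E[q1 [q1U Gq1 <-]].
  move=> /r2E[q2 [q2U Gq2 <-]] A GA; rewrite beta_mulA.
  have q1pU := beta_mul_ultra q1U pU.
  have : G `<=` beta_mul (beta_mul q1 p) q2.
    by apply: (GS (beta_mul q1 p) q2) => //; exact: GS.
  exact.
(* As [C p = C] contains [p], some [q] in [C] satisfies [q p = p]: the second subsemigroup is
   nonempty. *)
have DF := right_division_proper GF pU pU.
rewrite GpE in DF; have {DF} DF := DF Gp.
have DE : right_division G p p = G.
  apply: Gmax; last first.
    by move=> A GA; exists setT; [exact: filterT|apply: filterS GA => s As _].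
  split=> // q1 q2 q1U q2U.
  move=> /(right_divisionP GF pU q1U pU)[Gq1 q1p].
  move=> /(right_divisionP GF pU q2U pU)[Gq2 q2p].
  have q12U := beta_mul_ultra q1U q2U.
  apply/(right_divisionP GF pU q12U pU); split; first exact: GS.
  by rewrite -beta_mulA q2p.
exists p; split=> //; first exact: subset_trans Gp.
have /(right_divisionP GF pU pU pU)[] // : right_division G p p `<=` p.
by rewrite DE.
Qed.

End BetaSemigroup.

(** * Counting in finite sets *)

Definition trace (T : choiceType) (A : set T) (E : {fset T}) : {fset T} :=
  [fset a in E | a \in A]%fset.

Section Counting.
Variable T : choiceType.
Implicit Types (A B : set T) (E : {fset T}).

Lemma card_trace_le A E : (#|` trace A E| <= #|` E|)%N.
Proof. exact/fsubset_leq_card/fset_sub. Qed.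

Lemma in_trace A E a : (a \in trace A E) = (a \in E) && (a \in A).
Proof. by rewrite !inE. Qed.

Lemma trace_subset A E : {subset trace A E <= A}.
Proof. by move=> a; rewrite in_trace => /andP[]. Qed.


Lemma card_trace_setU A B E :
  (#|` trace (A `|` B) E| <= #|` trace A E| + #|` trace B E|)%N.
Proof.
apply: leq_trans (_ : #|` trace A E `|` trace B E|%fset <= _)%N.
  apply/fsubset_leq_card/fsubsetP => a.
  by rewrite in_fsetU !in_trace in_setU andb_orr.
by rewrite cardfsU leq_subr.
Qed.

(** [E] splits into the fibers of [f], each of size at most [b]. Applied to translations, this is
    how weak cancellativity enters. *)
Lemma card_fset_fibers (U : choiceType) (f : T -> U) (b : nat) E :
  (forall u, [set s | f s = u] #<= `I_b)%card ->
  (#|` E| <= #|` [fset f e | e in E]%fset| * b)%N.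
Proof.
move=> fb; rewrite card_fset_sum1 (partition_big_imfset _ f) /=.
apply: leq_trans (_ : (\sum_(u <- [fset f e | e in E]%fset) b)%N <= _)%N;
  last first.
  by rewrite big_const_seq count_predT iter_addn_0 mulnC.
apply: leq_sum => u _.
rewrite big_fset_condE -card_fset_sum1.
apply: leq_trans (geq_card_fset_set (fb u)).
apply/fsubset_leq_card/fsubsetP => e.
rewrite !inE /= => /andP[eE /eqP fe]; rewrite in_fset_set ?inE //.
by apply/finite_set_leP; exists b; exact: fb.
Qed.

End Counting.

(** * Positive upper Banach density and the ideal properties of D* *)

Section Density.
Variables (R : realType) (S : semigroupType).
Variables (I : Type) (le : I -> I -> Prop) (F : I -> {fset S}).
Hypothesis le_directed : directed le.
Hypothesis F_neq0 : forall i, F i != fset0.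
Implicit Types (A B : set S) (E : {fset S}) (p q : set_system S).

Local Notation density := (upper_banach_density R le F).

(** By conversion, the set of reals whose supremum is the density. *)
Definition frequently_dense A (alpha : R) := forall i0, exists2 i, le i0 i &
  exists s, alpha * #|` F i|%:R <= #|` trace A (rtranslate (F i) s)|%:R.

Lemma rtranslateA E (r s : option S) :
  exists u, rtranslate (rtranslate E r) s = rtranslate E u.
Proof.
case: r s => [r|] [s|] /=;
  [|by exists (Some r)|by exists (Some s)|by exists None].
exists (Some (r * s)%g) => /=; rewrite -imfset_comp.
by apply: eq_imfset => //= e; rewrite /= mulgA.
Qed.

Lemma rtranslate_ltranslate E t r :
  rtranslate (ltranslate t E) r = ltranslate t (rtranslate E r).
Proof.
case: r => //= r; rewrite /ltranslate -!imfset_comp.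
by apply: eq_imfset => //= e; rewrite /= mulgA.
Qed.

Lemma rtranslate_cover E E' r :
  (rtranslate E r `<=` rtranslate E' r `|` rtranslate (E `\` E') r)%fset.
Proof.
have E_sub : (E `<=` E' `|` E `\` E')%fset.
  by rewrite -fsubDset.
case: r => //= r; rewrite -imfsetU; apply: subset_imfset.
exact: (fsubsetP E_sub).
Qed.

Lemma card_rtranslate_le E s : (#|` rtranslate E s| <= #|` E|)%N.
Proof. by case: s => //= s; exact: leq_imfset_card. Qed.

Lemma card_F_gt0 i : 0 < #|` F i|%:R :> R.
Proof. by rewrite ltr0n cardfs_gt0. Qed.

Lemma density_gt0P A :
  0 < density A <-> exists2 alpha, 0 < alpha & frequently_dense A alpha.
Proof.
have [[i0] le_refl _ _] := le_directed.
have dense0 : frequently_dense A 0.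
  by move=> i; exists i => //; exists None; rewrite mul0r.
have dense_le1 : ubound (frequently_dense A) 1.
  move=> alpha /(_ i0)[i _ [s]]; rewrite -ler_pdivlMr ?card_F_gt0//.
  move=> /le_trans; apply; rewrite ler_pdivrMr ?card_F_gt0// mul1r ler_nat.
  exact: leq_trans (card_trace_le _ _) (card_rtranslate_le _ _).
split=> [dA|[alpha alpha0 dA]].
  (* With the density itself as tolerance, the approximating element is positive. *)
  have [|e eA] := sup_adherent dA (_ : has_sup (frequently_dense A)).
    by split; [exists 0|exists 1].
  by rewrite subrr; exists e.
by apply: lt_le_trans alpha0 _; apply: ub_le_sup dA; exists 1.
Qed.

Lemma density_set0 : ~ 0 < density set0.
Proof.
have [[i0] _ _ _] := le_directed.
move=> /density_gt0P[alpha alpha0 /(_ i0)[i _ [s]]]; apply/negP; rewrite -ltNge.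
apply: le_lt_trans (mulr_gt0 alpha0 (card_F_gt0 i)).
rewrite lern0 cardfs_eq0 -fsubset0; apply/fsubsetP => a.
by move/trace_subset; rewrite inE.
Qed.

Lemma density_gt0S A B : A `<=` B -> 0 < density A -> 0 < density B.
Proof.
move=> AB /density_gt0P[alpha alpha0 dA]; apply/density_gt0P; exists alpha => //.
move=> i0; have [i i0i [s sA]] := dA i0; exists i => //; exists s.
apply: le_trans sA _; rewrite ler_nat; apply/fsubset_leq_card/fsubsetP => a.
by rewrite !in_trace => /andP[-> /=]; rewrite !inE; exact: AB.
Qed.

(** Otherwise, beyond a common index, [A] and [B] each take up less than alpha/2 of every translate,
    so their union takes up less than alpha. *)
Lemma density_gt0U A B :
  0 < density (A `|` B) -> 0 < density A \/ 0 < density B.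
Proof.
move=> /density_gt0P[alpha alpha0 dAB]; apply: contrapT => /not_orP[nA nB].
have half C : ~ 0 < density C -> exists i0, forall i s, le i0 i ->
    #|` trace C (rtranslate (F i) s)|%:R < alpha / 2 * #|` F i|%:R.
  move=> nC; apply: contrapT => nC'; apply: nC; apply/density_gt0P.
  exists (alpha / 2); first by rewrite divr_gt0.
  move=> i0; apply: contrapT => ni; apply: nC'; exists i0 => i s i0i.
  by rewrite ltNge; apply/negP => si; apply: ni; exists i => //; exists s.
have [iA hA] := half _ nA; have [iB hB] := half _ nB.
have [_ _ le_trans' /(_ iA iB)[k [iAk iBk]]] := le_directed.
have [i ki [s]] := dAB k; apply/negP; rewrite -ltNge.
apply: le_lt_trans (_ : (#|` trace A (rtranslate (F i) s)| +
    #|` trace B (rtranslate (F i) s)|)%:R < _).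
  by rewrite ler_nat card_trace_setU.
rewrite natrD [alpha]splitr mulrDl ltrD //.
  by apply: hA; exact: le_trans' ki.
by apply: hB; exact: le_trans' ki.
Qed.

(** For [A] in [pq], the s with s^{-1}A in [q] have positive density. The finitely many such s in a
    translate of [F i] admit a common t with st in [A], and translating by t shrinks their number at
    most by a bounded factor. *)
Lemma Dstar_mulr (b : nat) p q : weakly_right_cancellative S b ->
  UltraFilter p -> UltraFilter q -> Dstar R le F p ->
  Dstar R le F (beta_mul p q).
Proof.
move=> Sb pU qU [_ pD]; split; first exact: beta_mul_ultra.
move=> A /pD/density_gt0P[alpha alpha0 dA]; apply/density_gt0P.
(* [b.+1] is also a bound on the fibers, and a positive divisor whatever [b] is. *)
have b0 : 0 < b.+1%:R :> R by [].
exists (alpha / b.+1%:R); first by rewrite divr_gt0.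
move=> i0; have [i i0i [r sE]] := dA i0; exists i => //.
set E := trace _ _ in sE.
have [t tE] : \bigcap_(s in [set` E]) left_quotient s A !=set0.
  apply: (@filter_ex _ q); apply: filter_bigI => s.
  by rewrite !inE /= => /andP[_]; rewrite inE.
have [u uE] := rtranslateA (F i) r (Some t); exists u; rewrite -{}uE.
rewrite mulrAC ler_pdivrMr//; apply: le_trans sE _; rewrite -natrM ler_nat.
apply: leq_trans (@card_fset_fibers _ _ (fun s => (s * t)%g) b.+1 E _) _.
  move=> v; apply: card_le_trans (Sb t v) _; by rewrite card_le_II.
rewrite leq_mul2r /=; apply/fsubset_leq_card/fsubsetP => _ /imfsetP[s /= sE' ->].
have := sE'; rewrite in_trace => /andP[sF _].
rewrite in_trace; apply/andP; split; last by rewrite inE; exact: tE.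
by apply/imfsetP; exists s.
Qed.

Lemma Dstar_mull (b : nat) p q : weakly_left_cancellative S b ->
  condition_star R le F ->
  UltraFilter p -> UltraFilter q -> Dstar R le F q ->
  Dstar R le F (beta_mul p q).
Proof.
move=> Sb Fstar pU qU [_ qD]; split; first exact: beta_mul_ultra.
move=> A /(@filter_ex _ p _)[t /qD/density_gt0P[alpha alpha0 dA]].
apply/density_gt0P.
have b0 : 0 < b.+1%:R :> R by [].
pose eps := alpha / b.+1%:R / 2.
have eps0 : 0 < eps by rewrite !divr_gt0.
have [c c0 [l Fl]] := Fstar eps t eps0.
have [_ _ le_trans' le_dir] := le_directed.
exists (eps / c%:R); first by rewrite divr_gt0 ?ltr0n.
move=> j0; have [k [j0k lk]] := le_dir j0 l.
have [i0 ki0 [r sE]] := dA k.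
have [i i0i [r' [Fi ci]]] := Fl i0 (le_trans' _ _ _ lk ki0).
exists i; first exact: le_trans' (le_trans' _ _ _ j0k ki0) i0i.
have [u uE] := rtranslateA (F i) r' r; exists u; rewrite -{}uE.
set E := trace _ _ in sE.
pose D := (ltranslate t (F i0) `\` rtranslate (F i) r')%fset.
have tE_sub : (ltranslate t E `<=`
    trace A (rtranslate (rtranslate (F i) r') r) `|` rtranslate D r)%fset.
  apply/fsubsetP => _ /imfsetP[e /= eE ->].
  have teA : (t * e)%g \in A by move/trace_subset: eE; rewrite !inE.
  have : (t * e)%g \in rtranslate (ltranslate t (F i0)) r.
    rewrite rtranslate_ltranslate; apply/imfsetP; exists e => //=.
    by move: eE; rewrite in_trace => /andP[].
  move/(fsubsetP (rtranslate_cover _ (rtranslate (F i) r') r)).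
  by rewrite !in_fsetU in_trace teA andbT.
have := fsubset_leq_card tE_sub; rewrite cardfsU => /leq_trans/(_ (leq_subr _ _)).
set N := #|` trace _ _| => NE.
have {}NE : (#|` E| <= (N + #|` D|) * b.+1)%N.
  apply: leq_trans (@card_fset_fibers _ _ (fun s => (t * s)%g) b.+1 E _) _.
    by move=> v; apply: card_le_trans (Sb t v) _; rewrite card_le_II.
  rewrite leq_mul2r /=; apply: leq_trans NE _.
  by rewrite leq_add2l card_rtranslate_le.
have {}NE : alpha / b.+1%:R * #|` F i0|%:R <= N%:R + #|` D|%:R.
  rewrite mulrAC ler_pdivrMr//; apply: le_trans sE _.
  by rewrite -natrD -natrM ler_nat.
have NF : eps * #|` F i0|%:R <= N%:R.
  rewrite -(lerD2r (eps * #|` F i0|%:R)) -mulrDl -splitr.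
  by apply: le_trans NE _; rewrite lerD2l ltW.
apply: le_trans NF; rewrite -mulrA ler_pM2l// ler_pdivrMl ?ltr0n//.
by rewrite -natrM ler_nat.
Qed.

End Density.

(** * The shift on {0,1}^(S u {1}) *)

Lemma cvg_prod_topology (I : Type) (K : I -> topologicalType)
    (G : set_system (prod_topology K)) (f : prod_topology K) : Filter G ->
  (forall i (V : set (K i)), nbhs (f i) V -> G [set g | V (g i)]) -> G --> f.
Proof.
move=> GF Gf; apply/cvg_sup => i U [_ [[V oV <-] /= Vfi] VU].
apply: filterS VU _; apply: Gf; exact: open_nbhs_nbhs.
Qed.

Section BooleanShift.
Variable S : semigroupType.

Definition shift_space : topologicalType :=
  prod_topology (fun _ : option S => bool).

(** The product u s lies in [S] even for u = 1. Thus (T_s z)(u) = z(us) never reads the coordinate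
    [None] of z, while the coordinate [None] of T_s z is z(s). *)
Definition adjoined_mul (u : option S) (s : S) : S :=
  if u is Some t then (t * s)%g else s.

Definition shift (s : S) (z : shift_space) : shift_space :=
  fun u => z (Some (adjoined_mul u s)).

Lemma shift_dynamical_system : dynamical_system shift.
Proof.
split.
- have := @tychonoff (option S) (fun=> bool) (fun=> setT) (fun=> bool_compact).
  by congr compact; apply/seteqP; split.
- apply: (@hausdorff_product (option S) (fun=> bool)) => _.
  exact: discrete_hausdorff.
- move=> s z; apply: cvg_prod_topology => u V Vz.
  exact: (@proj_continuous (option S) (fun=> bool) (Some (adjoined_mul u s))).
- move=> s t; apply/funext => z; apply/funext => u; rewrite /shift /=.
  by case: u => //= u; rewrite mulgA.
Qed.

End BooleanShift.

(** * Dynamical characterization of D-sets *)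

Theorem theorem3p7 (R : realType) (S : semigroupType) (hS : inhabited S)
    (I : Type) (le : I -> I -> Prop) (hI : directed le)
    (F : I -> {fset S}) (hF : forall i, F i != fset0)
    (hyp : (exists2 b : nat, (0 < b)%N & weakly_right_cancellative S b) \/
           ((exists2 b : nat, (0 < b)%N & weakly_left_cancellative S b) /\
            condition_star R le F))
    (A : set S) :
  D_set R le F A <->
  exists (X : topologicalType) (T : S -> X -> X) (x y : X),
    [/\ dynamical_system T,
        forall U : set X, nbhs y U ->
          0 < upper_banach_density R le F [set s | U (T s x) /\ U (T s y)] &
        exists2 Uy : set X, nbhs y Uy & A = [set s | Uy (T s x)]].
Proof.
split=> [[p [pU' pp [_ pD] pA]]|[X [T [x [y [TX dense [Uy yUy ->]]]]]]].
  have pU : UltraFilter p := pU'.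
  (* The value at the adjoined 1 is arbitrary. Below, [B u] is u^{-1}A, and [y u] records whether it
     belongs to [p]. *)
  pose x : shift_space S := fun u => if u is Some s then s \in A else true.
  pose B u : set S := [set s | x (Some (adjoined_mul u s))].
  pose y : shift_space S := fun u => `[< p (B u) >].
  have xy : (fun s => shift s x) @ p --> y.
    apply: cvg_prod_topology => u V.
    rewrite nbhs_principalE => /principal_filterP.
    rewrite /y; case: asboolP => [pB|/(ultra_setC _ pU) pB] Vy.
      by apply: (@filterS _ p _ _ _ _ pB) => s xus /=; rewrite /shift xus.
    apply: (@filterS _ p _ _ _ _ pB) => s /= /negP/negbTE xus.
    by rewrite /shift xus.
  have yE u s : y (Some (adjoined_mul u s)) = `[< p (left_quotient s (B u)) >].
    congr asbool; congr p; apply/funext => t; rewrite /B /left_quotient /=.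
    by case: u => //= u; rewrite mulgA.
  have yy : (fun s => shift s y) @ p --> y.
    apply: cvg_prod_topology => u V.
    rewrite nbhs_principalE => /principal_filterP.
    (* Reading [p] as [pp] turns membership of [B u] into membership of s^{-1}(B u) in [p] for
       [p]-most s, which by [yE] is the value of T_s y at [u]. *)
    rewrite {1}/y; case: asboolP => [|/(ultra_setC _ pU)]; rewrite -{1}pp => pB Vy.
      apply: (@filterS _ p _ _ _ _ pB) => s psB /=.
      by rewrite /shift yE asboolT.
    apply: (@filterS _ p _ _ _ _ pB) => s /(ultra_setC _ pU) psB /=.
    by rewrite /shift yE asboolF.
  exists (shift_space S), (@shift S), x, y; split.
  - exact: shift_dynamical_system.
  - by move=> U yU; apply: pD; apply: filterI; [exact: xy|exact: yy].
  (* This cylinder contains [y] because [B None] is [A], a member of [p]. *)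
  - exists [set z : shift_space S | z None].
      apply: (@proj_continuous (option S) (fun=> bool) None).
      rewrite nbhs_principalE; apply/principal_filterP => /=; apply/asboolP.
      by apply: (@filterS _ p _ _ _ _ pA) => s As; rewrite /B /= inE.
    by apply/seteqP; split=> s /=; rewrite /shift /= inE.
have [_ _ Tcont TM] := TX.
pose dens := upper_banach_density R le F.
pose ret U : set S := [set s | U (T s x) /\ U (T s y)].
(* The sets that contain some [ret U] up to density zero. The ultrafilters above this filter are
   those in D* along which T_s x and T_s y both tend to [y]. *)
pose G0 : set_system S := [set B | exists2 U, nbhs y U & ~ 0 < dens (ret U `\` B)].
have G0F : ProperFilter G0.
  split; first by move=> [U /dense]; rewrite setD0.
  split=> [|B C [U yU UB] [V yV VC]|B C BC [U yU UB]].
  - exists setT; first exact: filterT.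
    by rewrite setDT; exact: density_set0.
  - exists (U `&` V); first exact: filterI.
    rewrite setDIr => /(density_gt0U hI hF)[dU|dV].
      by apply: UB; apply: density_gt0S dU => // s [[[? ?] [? ?]]].
    by apply: VC; apply: density_gt0S dV => // s [[[? ?] [? ?]]].
  - exists U => //; apply: contra_not UB; apply: density_gt0S => // s [Us nCs].
    by split=> // /BC.
have G0D p : UltraFilter p -> G0 `<=` p -> Dstar R le F p.
  move=> pU G0p; split=> // B pB; apply: contrapT => nB.
  suff /(ultra_setC _ pU) : p (~` B) by [].
  apply: G0p; exists setT; first exact: filterT.
  by apply: contra_not nB; apply: density_gt0S => // s [_ /contrapT].
have G0ret p U : G0 `<=` p -> nbhs y U -> p (ret U).
  move=> G0p yU; apply: G0p; exists U => //.
  by rewrite setDv; exact: density_set0.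
have G0S : semigroup_filter G0.
  split=> // p q pU qU G0p G0q.
  have pqU := beta_mul_ultra pU qU.
  have pqD : Dstar R le F (beta_mul p q).
    case: hyp => [[b _ Sb]|[[b _ Sb] Fstar]].
      by apply: Dstar_mulr Sb _ _ _ => //; exact: G0D.
    by apply: Dstar_mull Sb _ _ _ _ => //; exact: G0D.
  (* For [p]-most s the point T_s y lies in an open [V], so T_s^{-1}V is a neighborhood of [y], to
     which [q]-most t bring both [x] and [y]. This is where the return of [y] itself is used. *)
  have pqret U : nbhs y U -> beta_mul p q (ret U).
    rewrite nbhsE => -[V [oV Vy] VU].
    have /(G0ret p V G0p) pV : nbhs y V by exact: open_nbhs_nbhs.
    apply: (@filterS _ p _ _ _ _ pV) => s [_ Vsy].
    have /(G0ret q _ G0q) qV : nbhs y (T s @^-1` V).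
      by apply: Tcont; exact: open_nbhs_nbhs.
    apply: (@filterS _ q _ _ _ _ qV) => t [Vtx Vty].
    by split; rewrite TM; exact: VU.
  (* If [B] were not in [pq], then [ret U] \ [B], of density zero, would be, against [pq] in D*. *)
  move=> B [U yU UB]; have [//|pqB] := in_ultra_setVsetC B pqU.
  case: UB; apply: (pqD.2); rewrite setDE.
  by apply: filterI => //; exact: pqret.
have [p [pU G0p pp]] := idempotent_ultrafilter G0S.
exists p; split=> //; first exact: G0D.
by apply: filterS (G0ret p _ G0p yUy) => s [].
Qed.
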